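(* Let $B$ be a supersoluble brace such that $B/\zeta_n(B)$ is finite for some $n\in\mathbb{N}$. Then $\Gamma_{n+1}(B)$ is finite.
   Context: A brace (skew left brace) is a set $B$ with two binary operations $+$ and $\cdot$ such that $(B,+)$ and $(B,\cdot)$ are groups and $a(b+c)=ab-a+ac$ for all $a,b,c\in B$. $\lambda_a(b)=-a+ab$ defines a homomorphism $\lambda\colon(B,\cdot)\to\operatorname{Aut}(B,+)$; $a*b=-a+ab-b$, and for subsets $X,Y$, $X*Y$ is the additive subgroup generated by all $x*y$. An ideal is a subset that is a subgroup of both groups, normal in both, and invariant under all $\lambda_b$; quotients by ideals are braces. $\operatorname{Soc}(B)=\operatorname{Ker}\lambda\cap Z(B,+)$, $\zeta(B)=\operatorname{Soc}(B)\cap Z(B,\cdot)$; $\zeta_0(B)=\{0\}$, $\zeta_{k+1}(B)/\zeta_k(B)=\zeta(B/\zeta_k(B))$. The lower central series is $\Gamma_1(B)=B$, $\Gamma_{k+1}(B)=\langle \Gamma_k(B)*B,\ B*\Gamma_k(B),\ [\Gamma_k(B),B]_+\rangle_+$ (subgroup of $(B,+)$ generated, $[\,,]_+$ the commutator in $(B,+)$). $B$ is supersoluble if there is a finite chain of ideals $\{0\}=I_0\le\dots\le I_m=B$ such that for each $i$, either $(I_{i+1}/I_i,+)$ is infinite cyclic and $I_{i+1}/I_i\le\operatorname{Soc}(B/I_i)$, or $I_{i+1}/I_i$ has prime order. *)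

(* Defs.v *)
From mathcomp Require Import ssreflect ssrbool ssrnat prime.
From Stdlib Require List.

Set Implicit Arguments.
Unset Strict Implicit.

Record brace (B : Type) := Brace {
  badd : B -> B -> B;
  bzero : B;
  bopp : B -> B;
  bmul : B -> B -> B;
  bone : B;
  binv : B -> B;
  baddA : forall a b c, badd a (badd b c) = badd (badd a b) c;
  badd0r : forall a, badd a bzero = a;
  badd0l : forall a, badd bzero a = a;
  baddNr : forall a, badd a (bopp a) = bzero;
  baddNl : forall a, badd (bopp a) a = bzero;
  bmulA : forall a b c, bmul a (bmul b c) = bmul (bmul a b) c;
  bmul1r : forall a, bmul a bone = a;
  bmul1l : forall a, bmul bone a = a;
  bmulVr : forall a, bmul a (binv a) = bone;
  bmulVl : forall a, bmul (binv a) a = bone;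
  bbrace : forall a b c,
    bmul a (badd b c) = badd (badd (bmul a b) (bopp a)) (bmul a c)
}.

Section BraceDefs.
Variables (B : Type) (BR : brace B).

Local Notation "a + b" := (badd BR a b).
Local Notation "- a" := (bopp BR a).
Local Notation z0 := (bzero BR).
Local Notation "a * b" := (bmul BR a b).

Definition blam (a b : B) : B := - a + a * b.
Definition bstar (a b : B) : B := (- a + a * b) + - b.
Definition bcommA (a b : B) : B := ((- a + - b) + a) + b.

(* x and y represent the same element of B/I (cosets x+I = y+I). *)
Definition bcong (I : B -> Prop) (x y : B) : Prop := I (- y + x).

Definition is_ideal (I : B -> Prop) : Prop :=
  I z0 /\
  (forall x y, I x -> I y -> I (x + y)) /\
  (forall x, I x -> I (- x)) /\
  (forall x y, I x -> I y -> I (x * y)) /\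
  (forall x, I x -> I (binv BR x)) /\
  (forall b x, I x -> I ((b + x) + - b)) /\
  (forall b x, I x -> I ((b * x) * binv BR b)) /\
  (forall b x, I x -> I (blam b x)).

(* Preimage in B of zeta(B/I) = Soc(B/I) ∩ Z(B/I,·), i.e. elements x whose
   class lies in Ker lambda, in Z(B/I,+) and in Z(B/I,·). *)
Definition zeta_mod (I : B -> Prop) (x : B) : Prop :=
  forall y, [/\ bcong I (blam x y) y,
                bcong I (x + y) (y + x)
              & bcong I (x * y) (y * x)].

Fixpoint zeta (k : nat) : B -> Prop :=
  match k with
  | O => fun x => x = z0
  | S k' => zeta_mod (zeta k')
  end.

Inductive addgen (X : B -> Prop) : B -> Prop :=
  | addgen_in : forall x, X x -> addgen X x
  | addgen_zero : addgen X z0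
  | addgen_add : forall x y, addgen X x -> addgen X y -> addgen X (x + y)
  | addgen_opp : forall x, addgen X x -> addgen X (- x).

Definition gamma_gens (G : B -> Prop) (z : B) : Prop :=
  exists a b, G a /\ (z = bstar a b \/ z = bstar b a \/ z = bcommA a b).

(* Lower central series: Gamma 1 = B, Gamma (k+1) = <Gamma_k*B, B*Gamma_k,
   [Gamma_k,B]_+>_+.  (Gamma 0 := B is an unused convention.) *)
Fixpoint Gamma (k : nat) : B -> Prop :=
  match k with
  | O => fun _ => True
  | S k' => match k' with
            | O => fun _ => True
            | S _ => addgen (gamma_gens (Gamma k'))
            end
  end.

Fixpoint bnatmul (n : nat) (g : B) : B :=
  match n with
  | O => z0
  | S n' => g + bnatmul n' g
  end.

Definition quot_inf_cyclic (J I : B -> Prop) : Prop :=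
  exists g, J g /\
    (forall x, J x -> exists k, bcong I x (bnatmul k g) \/ bcong I x (- bnatmul k g)) /\
    (forall k, 0 < k -> ~ bcong I (bnatmul k g) z0).

Definition quot_card (J I : B -> Prop) (p : nat) : Prop :=
  exists s : list B,
    List.length s = p /\
    (forall i, i < p -> J (List.nth i s z0)) /\
    (forall i j, i < p -> j < p -> i <> j ->
        ~ bcong I (List.nth i s z0) (List.nth j s z0)) /\
    (forall x, J x -> exists i, i < p /\ bcong I x (List.nth i s z0)).

Definition quot_in_soc (J I : B -> Prop) : Prop :=
  forall x, J x -> forall y, bcong I (blam x y) y /\ bcong I (x + y) (y + x).

Definition supersoluble : Prop :=
  exists (m : nat) (I : nat -> B -> Prop),
    (forall x, I O x <-> x = z0) /\
    (forall x, I m x) /\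
    (forall i, i <= m -> is_ideal (I i)) /\
    (forall i, i < m -> forall x, I i x -> I i.+1 x) /\
    (forall i, i < m ->
       (quot_inf_cyclic (I i.+1) (I i) /\ quot_in_soc (I i.+1) (I i))
       \/ (exists p, prime p /\ quot_card (I i.+1) (I i) p)).

Definition quot_finite (I : B -> Prop) : Prop :=
  exists s : list B, forall x, exists i, i < List.length s /\ bcong I x (List.nth i s z0).

Definition set_finite (X : B -> Prop) : Prop :=
  exists s : list B, forall x, X x -> List.In x s.

End BraceDefs.

(* Main.v *)
(** By induction on [n], applied over an arbitrary ideal [I], one finds an ideal
    [T] above [I] with [T / I] finite and [B / T] equal to its own [zeta_n].
    Induction over [zeta_1 (B / I)] gives an ideal [F] such that [F] is finite
    over [zeta_1 (B / I)] and [B / F] equals its own [zeta_n]; take for [T] the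
    elements of [F] of finite additive order modulo [I].  Since [F / I] has a
    central subgroup of finite index, the transfer is a homomorphism from [F / I]
    to an abelian group that preserves and reflects torsion, so [T] is a
    subgroup.  Any additive endomorphism that fixes [zeta_1] and preserves [F]
    acts trivially on [F / T], and each [lambda_x] with [x] in [F] acts
    trivially on [B / T]; hence [T] is an ideal and [F / T <= zeta_1 (B / T)].
    Supersolubility makes the torsion group [T / I] finite.  For [I = 0],
    [Gamma_(n+1)] is contained in the finite ideal [T]. *)

Require Import Defs.
From HB Require Import structures.
From mathcomp Require Import ssreflect ssrfun ssrbool eqtype ssrnat seq div.
From mathcomp Require Import fintype bigop prime.
From Stdlib Require Import Classical IndefiniteDescription FunctionalExtensionality.
From Stdlib Require Import PropExtensionality ProofIrrelevance.
From Stdlib Require List.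

Set Implicit Arguments.
Unset Strict Implicit.

(** * Elementary identities in a brace, and ideals *)

Section BraceTheory.
Variables (B : Type) (BR : brace B).

Local Notation "a + b" := (badd BR a b).
Local Notation "- a" := (bopp BR a).
Local Notation z0 := (bzero BR).
Local Notation "a * b" := (bmul BR a b).
Local Notation inv := (binv BR).
Local Notation lam := (blam BR).
Local Notation "n .* g" := (bnatmul BR n g) (at level 40).

Lemma baddK a b : (a + b) + - b = a.
Proof. by rewrite -baddA baddNr badd0r. Qed.

Lemma baddNK a b : (a + - b) + b = a.
Proof. by rewrite -baddA baddNl badd0r. Qed.

Lemma baddI a b c : a + b = a + c -> b = c.
Proof. by move=> /(f_equal (badd BR (- a))); rewrite !baddA baddNl !badd0l. Qed.

Lemma baddIr a b c : b + a = c + a -> b = c.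
Proof. by move=> /(f_equal (fun x => x + - a)); rewrite !baddK. Qed.

Lemma bopp_uniq a b : a + b = z0 -> b = - a.
Proof. by move=> h; apply: (@baddI a); rewrite h baddNr. Qed.

Lemma boppK a : - - a = a.
Proof. by symmetry; apply: bopp_uniq; rewrite baddNl. Qed.

Lemma bopp0 : - z0 = z0.
Proof. by symmetry; apply: bopp_uniq; rewrite badd0l. Qed.

Lemma boppD a b : - (a + b) = - b + - a.
Proof. by symmetry; apply: bopp_uniq; rewrite baddA baddK baddNr. Qed.

Lemma bmulI a b c : a * b = a * c -> b = c.
Proof. by move=> /(f_equal (bmul BR (inv a))); rewrite !bmulA bmulVl !bmul1l. Qed.

Lemma binvK a : inv (inv a) = a.
Proof. by apply: (@bmulI (inv a)); rewrite bmulVr bmulVl. Qed.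

(** The brace identity with [b = c = 0] reads [a0 = a0 - a + a0], and [- a + a0] cancels. Hence both
    groups share their neutral element. *)
Lemma bmul0 a : a * z0 = a.
Proof.
have := bbrace BR a z0 z0; rewrite badd0l => h.
apply: (@baddIr (- a + a * z0)).
by rewrite !baddA -h baddNr badd0l.
Qed.

Lemma bone0 : bone BR = z0.
Proof. by rewrite -[LHS]bmul0 bmul1l. Qed.

Lemma bmulE a b : a * b = a + lam a b.
Proof. by rewrite /blam baddA baddNr badd0l. Qed.

Lemma blamD a b c : lam a (b + c) = lam a b + lam a c.
Proof. by rewrite /blam bbrace !baddA. Qed.

Lemma blam0 a : lam a z0 = z0.
Proof. by rewrite /blam bmul0 baddNl. Qed.

Lemma blamN a b : lam a (- b) = - lam a b.
Proof. by apply: bopp_uniq; rewrite -blamD baddNr blam0. Qed.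

Lemma blamM a b c : lam (a * b) c = lam a (lam b c).
Proof.
by rewrite {3}/blam blamD blamN /blam boppD boppK -bmulA !baddA baddK.
Qed.

Lemma blam_zero b : lam z0 b = b.
Proof. by rewrite /blam bopp0 badd0l -bone0 bmul1l. Qed.

Lemma blamVK a b : lam a (lam (inv a) b) = b.
Proof. by rewrite -blamM bmulVr bone0 blam_zero. Qed.

Lemma blamKV a b : lam (inv a) (lam a b) = b.
Proof. by rewrite -blamM bmulVl bone0 blam_zero. Qed.

Lemma binvE x : inv x = lam (inv x) (- x).
Proof.
rewrite -[LHS](blamKV x); congr (lam _ _); apply: bopp_uniq.
by rewrite -bmulE bmulVr bone0.
Qed.

Lemma bnatmulSr n g : n.+1 .* g = n .* g + g.
Proof.
elim: n => [|n ih] /=; first by rewrite badd0l badd0r.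
by rewrite -baddA -ih.
Qed.

Lemma bnatmulD m n g : (m + n)%N .* g = m .* g + n .* g.
Proof. by elim: m => [|m ih] /=; rewrite ?badd0l // -baddA -ih. Qed.

Lemma bnatmulM m n g : (m * n)%N .* g = m .* (n .* g).
Proof. by elim: m => [|m ih] //=; rewrite mulSn bnatmulD ih. Qed.

Lemma bnatmul0 n : n .* z0 = z0.
Proof. by elim: n => [|n ih] //=; rewrite ih badd0l. Qed.

Lemma bnatmulN n g : n .* (- g) = - (n .* g).
Proof.
elim: n => [|n ih]; first by rewrite /= bopp0.
by rewrite bnatmulSr ih /= boppD.
Qed.

Lemma bnatmul_comm n a b : a + b = b + a -> n .* a + b = b + n .* a.
Proof.
by move=> h; elim: n => [|n ih] /=; rewrite ?badd0l ?badd0r // -baddA ih !baddA h.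
Qed.

Lemma bnatmul_commD n a b : a + b = b + a -> n .* (a + b) = n .* a + n .* b.
Proof.
move=> h; elim: n => [|n ih] /=; first by rewrite badd0l.
by rewrite ih !baddA -(baddA BR a b) -(bnatmul_comm n h) !baddA.
Qed.

Lemma bnatmul_morph (f : B -> B) n g :
  (forall x y, f (x + y) = f x + f y) -> f (n .* g) = n .* f g.
Proof.
move=> fD; have f0 : f z0 = z0.
  by apply: (@baddI (f z0)); rewrite -fD !badd0r.
by elim: n => [|n ih] //=; rewrite fD ih.
Qed.

(** The additive half of [is_ideal], isolated because torsion sets and the layers of a chain are
    handled by additive cosets alone. *)
Definition normal_add (I : B -> Prop) : Prop :=
  [/\ I z0, forall x y, I x -> I y -> I (x + y), forall x, I x -> I (- x)
    & forall b x, I x -> I ((b + x) + - b)].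

Lemma ideal_normal_add I : is_ideal BR I -> normal_add I.
Proof. by move=> [h0 [hD [hN [_ [_ [hJ _]]]]]]; split. Qed.

Lemma ideal_lam I b x : is_ideal BR I -> I x -> I (lam b x).
Proof. by move=> [_ [_ [_ [_ [_ [_ [_ h]]]]]]]; apply: h. Qed.

Lemma ideal_conj I b x : is_ideal BR I -> I x -> I ((b * x) * inv b).
Proof. by move=> [_ [_ [_ [_ [_ [_ [h _]]]]]]]; apply: h. Qed.

Lemma ideal_conjV I b x : is_ideal BR I -> I x -> I ((inv b * x) * b).
Proof. by move=> h /(@ideal_conj _ (inv b) _ h); rewrite binvK. Qed.

(** Multiplicative closure comes from [xy = x + lam x y], and closure under inverses from
    [inv x = lam (inv x) (- x)]. *)
Lemma is_ideal_intro I : normal_add I -> (forall b x, I x -> I (lam b x)) ->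
  (forall b x, I x -> I ((b * x) * inv b)) -> is_ideal BR I.
Proof.
move=> [h0 hD hN hJ] hL hM; do ![split] => //.
- by move=> x y hx hy; rewrite bmulE; apply: hD => //; apply: hL.
- by move=> x hx; rewrite binvE; apply/hL/hN.
Qed.

(** * Congruence modulo additive normal subgroups and modulo ideals *)

Section Congruence.
Variables (I : B -> Prop) (hI : normal_add I).
Local Notation "x ~ y" := (bcong BR I x y) (at level 70).

Lemma normal_addJ b x : I x -> I ((- b + x) + b).
Proof. by case: hI => _ _ _ /(_ (- b) x); rewrite boppK. Qed.

Lemma bcong_refl x : x ~ x.
Proof. by rewrite /bcong baddNl; case: hI. Qed.

Lemma bcong_sym x y : x ~ y -> y ~ x.
Proof.
by case: hI => _ _ hN _ /hN; rewrite /bcong boppD boppK.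
Qed.

Lemma bcong_trans y x z : x ~ y -> y ~ z -> x ~ z.
Proof.
case: hI => _ hD _ _ h1 h2; move: (hD _ _ h2 h1).
by rewrite /bcong baddA baddK.
Qed.

Lemma bcongD x x' y y' : x ~ x' -> y ~ y' -> x + y ~ x' + y'.
Proof.
case: hI => _ hD _ _ hx hy; move: (hD _ _ (normal_addJ y' hx) hy).
by rewrite /bcong boppD !baddA baddK.
Qed.

Lemma bcongN x y : x ~ y -> - x ~ - y.
Proof.
case: hI => _ _ hN hJ /hN/(hJ y).
by rewrite /bcong boppD boppK !baddA baddK.
Qed.

Lemma bcong_natmul n x y : x ~ y -> n .* x ~ n .* y.
Proof.
by move=> h; elim: n => [|n ih] /=; [apply: bcong_refl | apply: bcongD].
Qed.

Lemma bcong0 x : x ~ z0 <-> I x.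
Proof. by rewrite /bcong bopp0 badd0l. Qed.

Lemma bcong_mem (J : B -> Prop) x y : normal_add J ->
  (forall u, I u -> J u) -> x ~ y -> J y -> J x.
Proof.
move=> [_ hD _ _] hIJ /hIJ h hy.
by have := hD _ _ hy h; rewrite baddA baddNr badd0l.
Qed.

Lemma bcongP x y : x ~ y <-> exists2 w, I w & x = y + w.
Proof.
split=> [h|[w hw ->]]; last by rewrite /bcong baddA baddNl badd0l.
by exists (- y + x) => //; rewrite baddA baddNr badd0l.
Qed.

Lemma bcong_diff x y : x ~ y <-> I (x + - y).
Proof.
case: hI => _ _ _ hJ; split=> [/(hJ y)|/(normal_addJ y)].
- by rewrite baddA baddNr badd0l.
- by rewrite /bcong baddA baddNK.
Qed.

End Congruence.

(** Additive and multiplicative cosets of an ideal agree, since [yw = y + lam y w] and [lam y]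
    permutes the ideal. *)
Lemma bcong_mulP I x y : is_ideal BR I ->
  bcong BR I x y <-> exists2 w, I w & x = y * w.
Proof.
move=> hI; rewrite bcongP; split=> -[w hw ->].
- exists (lam (inv y) w); first exact: ideal_lam.
  by rewrite bmulE blamVK.
- by exists (lam y w); [apply: ideal_lam | rewrite bmulE].
Qed.

Lemma bcongM I x x' y y' : is_ideal BR I ->
  bcong BR I x x' -> bcong BR I y y' -> bcong BR I (x * y) (x' * y').
Proof.
move=> hI /(bcong_mulP _ _ hI)[u hu ->] /(bcong_mulP _ _ hI)[v hv ->].
apply/(bcong_mulP _ _ hI); exists (((inv y' * u) * y') * v).
  by case: (hI) => _ [_ [_ [hM _]]]; apply: hM => //; apply: ideal_conjV.
by rewrite !bmulA -(bmulA BR x' y') bmulVr bmul1r.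
Qed.

Lemma bcongV I x y : is_ideal BR I ->
  bcong BR I x y -> bcong BR I (inv x) (inv y).
Proof.
move=> hI /(bcong_mulP _ _ hI)[u hu ->].
apply/(bcong_mulP _ _ hI); exists ((y * inv u) * inv y).
  by apply: ideal_conj => //; case: hI => _ [_ [_ [_ [hV _]]]]; apply: hV.
apply: (@bmulI (y * u)).
by rewrite bmulVr !bmulA -(bmulA BR _ (inv y) y) bmulVl bmul1r -(bmulA BR y u)
  bmulVr bmul1r bmulVr.
Qed.

Lemma zeta_mod_mono (I J : B -> Prop) x :
  (forall u, I u -> J u) -> zeta_mod BR I x -> zeta_mod BR J x.
Proof. by move=> h hx y; case: (hx y) => *; split; apply: h. Qed.

(** * The zero ideal and the annihilator [zeta_1] *)

Lemma zero_normal_add : normal_add (fun x => x = z0).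
Proof.
split=> // [x y -> ->|x ->|b x ->]; first by rewrite badd0l.
- exact: bopp0.
- by rewrite badd0r baddNr.
Qed.

Lemma zero_ideal : is_ideal BR (fun x => x = z0).
Proof.
apply: is_ideal_intro; first exact: zero_normal_add.
- by move=> b x ->; apply: blam0.
- by move=> b x ->; rewrite bmul0 bmulVr bone0.
Qed.

Lemma bcong_zero x y : bcong BR (fun x => x = z0) x y <-> x = y.
Proof.
rewrite (bcongP); split=> [[w -> ->]|->]; first by rewrite badd0r.
by exists z0; rewrite ?badd0r.
Qed.

(** Once [lam x] is trivial and [x] is additively central, [xy = yx] amounts to
    [y + lam y x = y + x], that is, to [x] being fixed by every [lam y]. *)
Lemma zeta1P x : zeta_mod BR (fun x => x = z0) x <->
  forall y, [/\ lam x y = y, lam y x = x & x + y = y + x].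
Proof.
split=> h y; case: (h y).
- move=> /bcong_zero h1 /bcong_zero h2 /bcong_zero h3; split=> //.
  by rewrite /blam -h3 bmulE h1 h2 baddA baddNl badd0l.
- by move=> h1 h2 h3; split; apply/bcong_zero => //; rewrite !bmulE h1 h2.
Qed.

(** On the annihilator the two group structures coincide, [x + y = xy] and [- x = inv x], so [lam]
    of a sum or of an opposite is a composite or an inverse of trivial maps. *)
Lemma zeta1_ideal : is_ideal BR (zeta_mod BR (fun x => x = z0)).
Proof.
apply: is_ideal_intro; first split.
- by apply/zeta1P => y; rewrite blam_zero blam0 badd0l badd0r.
- move=> x y /zeta1P hx /zeta1P hy.
  have e : x + y = x * y by rewrite bmulE; case: (hx y) => ->.
  apply/zeta1P => b; case: (hx b) (hy b) => [h1 h2 h3] [k1 k2 k3].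
  rewrite {1}e blamM k1 h1 blamD h2 k2; split=> //.
  by rewrite -baddA k3 baddA h3 baddA.
- move=> x /zeta1P hx.
  have e : - x = inv x.
    apply: (@bmulI x); rewrite bmulVr bone0 bmulE.
    by case: (hx (- x)) => -> _ _; rewrite baddNr.
  apply/zeta1P => b; case: (hx b) => [h1 h2 h3].
  rewrite blamN h2 e -{1}h1 blamKV -e; split=> //.
  by apply: (@baddI x); rewrite !baddA baddNr badd0l h3 baddK.
- move=> b x hx; move/zeta1P: (hx) => /(_ b)[_ _ <-].
  by rewrite baddK.
- by move=> b x hx; move/zeta1P: (hx) => /(_ b)[_ -> _].
- move=> b x hx; move/zeta1P: (hx) => /(_ b)[h1 h2 h3].
  suff -> : b * x = x * b by rewrite -bmulA bmulVr bmul1r.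
  by rewrite !bmulE h1 h2.
Qed.

(** * Finite coverings by cosets, transversals and pigeonhole *)

Definition finite_mod (A C : B -> Prop) : Prop :=
  exists l : list B, forall x, A x -> exists2 r, List.In r l & bcong BR C x r.

(** The list in [finite_mod] may leave [A] and repeat cosets. Here the representatives are moved
    into [A] and made pairwise incongruent. *)
Lemma transversal (A C : B -> Prop) : normal_add C -> finite_mod A C ->
  exists N (r : 'I_N -> B), [/\ forall i, A (r i),
    forall x, A x -> exists i, bcong BR C x (r i)
    & forall i j, bcong BR C (r i) (r j) -> i = j].
Proof.
move=> hC [l hl].
suff [N [r [hA hcov hinj]]] : exists N (r : 'I_N -> B), [/\ forall i, A (r i),
    forall x, A x -> (exists2 y, List.In y l & bcong BR C x y) ->
      exists i, bcong BR C x (r i)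
    & forall i j, bcong BR C (r i) (r j) -> i = j].
  by exists N, r; split=> // x hx; apply: hcov => //; apply: hl.
elim: l {hl} => [|a l [N [r [hA hcov hinj]]]].
  exists 0, (fun=> z0); split; try by case.
  by move=> x _ [].
(* A representative is added only if the coset of [a] contains an element of [A] not yet covered,
   and that element is taken instead of [a]. *)
have [[x [hx hxa hxr]]|hno] := classic (exists x, [/\ A x, bcong BR C x a
    & forall i, ~ bcong BR C x (r i)]); last first.
  exists N, r; split=> // x hx [y /= [<-|hy] hxy].
    2: by apply: hcov => //; exists y.
  apply: NNPP => hn; apply: hno; exists x; split=> // i hi.
  by apply: hn; exists i.
exists N.+1, (fun i => if unlift ord0 i is Some j then r j else x); split.
- by move=> i; case: unliftP.
- move=> y hy [z /= [<-|hz] hyz].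
    exists ord0; rewrite unlift_none.
    by apply: (bcong_trans hC hyz); apply: bcong_sym.
  have [|i hi] := hcov _ hy; first by exists z.
  by exists (lift ord0 i); rewrite liftK.
- move=> i j; case: unliftP => [i'|] ->; case: unliftP => [j'|] -> // h.
  + by rewrite (hinj _ _ h).
  + by case: (hxr i'); apply: bcong_sym.
  + by case: (hxr j').
Qed.

(** With [N] cosets, two of the first [N + 1] terms are congruent. The sequence is arbitrary so as
    to serve both for multiples and for powers. *)
Lemma pigeonhole (A C : B -> Prop) (f : nat -> B) : normal_add C ->
  finite_mod A C -> (forall i, A (f i)) ->
  exists i k, 0 < k /\ bcong BR C (f (i + k)%N) (f i).
Proof.
move=> hC /(transversal hC)[N [r [_ hcov _]]] hf.
have /functional_choice [g hg] : forall i, exists j, bcong BR C (f i) (r j).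
  by move=> i; apply: hcov.
have: ~~ injectiveb (fun i : 'I_N.+1 => g i).
  apply/negP => /injectiveP /leq_card.
  by rewrite !card_ord ltnn.
case/injectivePn => i [j hij hgij].
have h : bcong BR C (f i) (f j).
  by apply: (bcong_trans hC (hg i)); rewrite hgij; apply: bcong_sym.
have [lt|lt|e] := ltngtP i j; last by case/eqP: hij; apply: val_inj.
- exists i, (j - i)%N; rewrite subn_gt0 subnKC ?(ltnW lt) //.
  by split=> //; apply: bcong_sym.
- by exists j, (i - j)%N; rewrite subn_gt0 subnKC ?(ltnW lt).
Qed.

(** Sums of a representative modulo [C] and one modulo [D] suffice: the former lies in [A], so
    subtracting it from [x] lands in the intersection of [A] and [C]. *)
Lemma finite_mod_tower (A C D : B -> Prop) : normal_add C -> normal_add D ->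
  (forall x y, A x -> A y -> A (x + y)) -> (forall x, A x -> A (- x)) ->
  finite_mod A C -> finite_mod (fun x => A x /\ C x) D -> finite_mod A D.
Proof.
move=> hC hD hAD hAN /(transversal hC)[N [r [hA hcov _]]] [l hl].
exists (List.flat_map (fun i => List.map (badd BR (r i)) l) (enum 'I_N)).
move=> x hx; have [i hi] := hcov x hx.
have [|y hy hxy] := hl (- r i + x).
  by split=> //; apply: hAD => //; apply: hAN.
exists (r i + y).
  apply/List.in_flat_map; exists i; split; last exact: List.in_map.
  elim: (enum 'I_N) (mem_enum 'I_N i) => //= j s ih.
  by rewrite in_cons => /orP[/eqP ->|/ih]; [left | right].
have := bcongD hD (bcong_refl hD (r i)) hxy.
by rewrite baddA baddNr badd0l.
Qed.

End BraceTheory.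

(** * The additive centre as a commutative monoid *)

Section AdditiveCenter.
Variables (B : Type) (BR : brace B).

(** Bundled as a type so that the transfer is a big operator over a commutative law, which may be
    split and reindexed. *)
Definition center : Type := {x : B | forall y, badd BR x y = badd BR y x}.

Definition center0 : center.
Proof. by exists (bzero BR) => y; rewrite badd0l badd0r. Defined.

Definition center_add (u v : center) : center.
Proof.
exists (badd BR (sval u) (sval v)) => y.
by case: u v => [u hu] [v hv] /=; rewrite -baddA hv !baddA hu.
Defined.

Lemma center_inj (u v : center) : sval u = sval v -> u = v.
Proof.
case: u v => u hu [v hv] /= e; subst v.
by congr exist; apply: proof_irrelevance.
Qed.

Lemma center_addA : associative center_add.
Proof. by move=> u v w; apply: center_inj; rewrite /= baddA. Qed.

Lemma center_addC : commutative center_add.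
Proof. by move=> u v; apply: center_inj; case: u => u /= ->. Qed.

Lemma center_add0 : left_id center0 center_add.
Proof. by move=> u; apply: center_inj; rewrite /= badd0l. Qed.

HB.instance Definition _ :=
  Monoid.isComLaw.Build center center0 center_add
    center_addA center_addC center_add0.

End AdditiveCenter.

(** * The transfer into a central subgroup of finite index *)

Section Transfer.
Variables (B : Type) (BR : brace B).

Local Notation "a + b" := (badd BR a b).
Local Notation "- a" := (bopp BR a).
Local Notation z0 := (bzero BR).
Local Notation "n .* g" := (bnatmul BR n g) (at level 40).

(** For a transversal [r] of [Z] in [F], write [r i + x = r j + c] with [c] in [Z]; then [V x] is
    the sum of these central [c] over all [i]. *)
Lemma transfer (F Z : B -> Prop) :
  F z0 -> (forall x y, F x -> F y -> F (x + y)) -> normal_add BR Z ->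
  (forall z, Z z -> F z) -> (forall z y, Z z -> z + y = y + z) ->
  finite_mod BR F Z ->
  exists N (V : B -> B), [/\ 0 < N,
    forall x y, F x -> F y -> V (x + y) = V x + V y,
    forall x y, F x -> V x + y = y + V x
    & forall z, Z z -> V z = N .* z].
Proof.
move=> F0 FD hZ ZF Zc /(transversal hZ)[N [r [Fr hcov hinj]]].
have N0 : 0 < N by have [i _] := hcov _ F0; apply: leq_ltn_trans (ltn_ord i).
have /functional_choice[f hf] : forall xi : B * 'I_N,
    exists p : 'I_N * center BR, F xi.1 ->
      r xi.2 + xi.1 = r p.1 + sval p.2 /\ Z (sval p.2).
  (* Outside [F] the pair is a default value; every later appeal to [hf] supplies membership in
     [F]. *)
  move=> [x i] /=; have [hx|hx] := classic (F x); last by exists (i, center0 BR).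
  have [j hj] := hcov _ (FD _ _ (Fr i) hx).
  pose c : center BR :=
    exist (fun u => forall y, u + y = y + u) _ (fun y => Zc _ y hj).
  exists (j, c) => _ /=.
  by split=> //; rewrite !baddA baddNr badd0l.
have uniq x i j (c : center BR) : F x -> r i + x = r j + sval c -> Z (sval c) ->
    f (x, i) = (j, c).
  move=> hx hj hc; have [/= e he] := hf (x, i) hx.
  case: (f (x, i)) e he => j' c' /= e he.
  have ej : j' = j.
    apply: hinj; apply: (@bcong_trans _ _ _ hZ (r i + x)).
      by apply: bcong_sym => //; apply/bcongP; exists (sval c').
    by apply/bcongP; exists (sval c).
  subst j'; congr (_, _); apply: center_inj.
  by apply: (@baddI _ BR (r j)); rewrite -e.
exists N, (fun x => sval (\big[@center_add _ BR/center0 BR]_(i < N) (f (x, i)).2)).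
split=> //.
- move=> x y hx hy.
  (* The map induced on coset indices by adding [x] on the right. *)
  pose s i := (f (x, i)).1.
  have fD i : f (x + y, i) =
      ((f (y, s i)).1, center_add (f (x, i)).2 (f (y, s i)).2).
    have [/= e1 h1] := hf (x, i) hx; have [/= e2 h2] := hf (y, s i) hy.
    apply: uniq; [exact: FD | | by case: hZ => _ h _ _; apply: h].
    rewrite baddA e1 /= -baddA -/(s i) (svalP (f (x, i)).2) baddA e2 -!baddA.
    by congr (_ + _); rewrite (svalP (f (x, i)).2).
  rewrite (eq_bigr (fun i => center_add (f (x, i)).2 (f (y, s i)).2)); last first.
    by move=> i _; rewrite fD.
  rewrite big_split /=; congr (_ + sval _).
  (* [s] is a permutation: equal images make [r i + x] and [r j + x] congruent modulo [Z], and [x]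
     cancels. *)
  rewrite [RHS](reindex_inj (h := s)) // => i j sij.
  apply: hinj; have [/= e1 h1] := hf (x, i) hx; have [/= e2 h2] := hf (x, j) hx.
  rewrite /s in sij.
  have e : bcong BR Z (r i + x) (r j + x).
    apply: (@bcong_trans _ _ _ hZ (r (f (x, i)).1)).
      by rewrite e1; apply/bcongP; exists (sval (f (x, i)).2).
    apply: bcong_sym => //; rewrite e2 sij; apply/bcongP.
      by exists (sval (f (x, j)).2).
  by have := bcongD hZ e (bcong_refl hZ (- x)); rewrite !baddK.
- by move=> x y _; case: (\big[_/_]_(i < N) _) => u hu; apply: hu.
- move=> z hz; pose c : center BR :=
    exist (fun u => forall y, u + y = y + u) z (fun y => Zc _ y hz).
  (* An element of [Z] fixes every coset, so each of the [N] summands is [z] itself. *)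
  rewrite (eq_bigr (fun=> c)) => [|i _]; last first.
    by rewrite (@uniq z i i c) //; apply: ZF.
  by rewrite big_const card_ord; elim: (N) => //= n ->.
Qed.

End Transfer.

(** * Torsion in an ideal that is finite over the annihilator *)

Section TorsionOverAnnihilator.
Variables (B : Type) (BR : brace B).

Local Notation "a + b" := (badd BR a b).
Local Notation "- a" := (bopp BR a).
Local Notation z0 := (bzero BR).
Local Notation "a * b" := (bmul BR a b).
Local Notation inv := (binv BR).
Local Notation lam := (blam BR).
Local Notation "n .* g" := (bnatmul BR n g) (at level 40).

Definition torsion (x : B) : Prop := exists2 k, 0 < k & k .* x = z0.

Lemma torsionD x y : x + y = y + x -> torsion x -> torsion y -> torsion (x + y).
Proof.
move=> hxy [k k0 hk] [l l0 hl]; exists (k * l)%N; first by rewrite muln_gt0 k0.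
by rewrite bnatmul_commD // {1}mulnC !bnatmulM hk hl !bnatmul0 badd0l.
Qed.

Lemma torsionN x : torsion x -> torsion (- x).
Proof. by case=> k k0 hk; exists k; rewrite // bnatmulN hk bopp0. Qed.

Lemma torsion_natmul n x : 0 < n -> torsion (n .* x) -> torsion x.
Proof.
by move=> n0 [k k0 hk]; exists (k * n)%N; rewrite ?muln_gt0 ?k0 // bnatmulM.
Qed.

Lemma torsion_morph (f : B -> B) x :
  (forall y z, f (y + z) = f y + f z) -> torsion x -> torsion (f x).
Proof.
move=> fD [k k0 hk]; exists k => //; rewrite -bnatmul_morph // hk.
by apply: (@baddI _ BR (f z0)); rewrite -fD !badd0r.
Qed.

Variable F : B -> Prop.
Hypothesis F_ideal : is_ideal BR F.
Local Notation Z := (zeta_mod BR (fun x => x = z0)).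
Hypothesis ZF : forall z, Z z -> F z.
Hypothesis F_fin : finite_mod BR F Z.

Definition torsion_in (x : B) : Prop := F x /\ torsion x.
Local Notation T := torsion_in.

Let Z_ideal : is_ideal BR Z := zeta1_ideal BR.
Let F_add : normal_add BR F := ideal_normal_add F_ideal.
Let F0 : F z0. Proof. by case: F_add. Qed.
Let FD x y : F x -> F y -> F (x + y).
Proof. by case: F_add => _ h _ _; apply: h. Qed.
Let FN x : F x -> F (- x). Proof. by case: F_add => _ _ h _; apply: h. Qed.
Let FJ b x : F x -> F ((b + x) + - b).
Proof. by case: F_add => _ _ _ h; apply: h. Qed.

Let F_natmul n x : F x -> F (n .* x).
Proof. by move=> hx; elim: n => //= n ih; apply: FD. Qed.

Lemma natmul_annihilator x : F x -> exists2 m, 0 < m & Z (m .* x).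
Proof.
move=> hx; have Zadd := ideal_normal_add Z_ideal.
have [i [k [k0]]] := pigeonhole Zadd F_fin (fun i => F_natmul i hx).
by rewrite /bcong bnatmulD baddA baddNl badd0l; exists k.
Qed.

(** The iterate is the multiplicative power of [x], as [z0] is also the multiplicative unit.
    Congruent powers differ by a right factor in [Z], and the common left power cancels. *)
Lemma power_annihilator x : F x -> exists2 m, 0 < m & Z (iter m (bmul BR x) z0).
Proof.
move=> hx; have Zadd := ideal_normal_add Z_ideal.
have Fpow i : F (iter i (bmul BR x) z0).
  elim: i => //= i ih; rewrite bmulE; apply: FD => //.
  exact: ideal_lam.
have powD i k : iter (i + k)%N (bmul BR x) z0 =
    iter i (bmul BR x) z0 * iter k (bmul BR x) z0.
  elim: i => [|i ih]; first by rewrite /= -bone0 bmul1l.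
  by rewrite addSn /= ih bmulA.
have [i [k [k0 /(bcong_mulP _ _ Z_ideal)[w hw]]]] := pigeonhole Zadd F_fin Fpow.
by rewrite powD => /(bmulI (BR := BR)) e; exists k; rewrite ?e.
Qed.

(** Reflection of torsion: if [m x] lies in [Z] and [k] kills [V x], then
    [k N m x = k V (m x) = k m V x = 0]. *)
Lemma transfer_torsion : exists V : B -> B,
  [/\ forall x y, F x -> F y -> V (x + y) = V x + V y,
      forall x y, F x -> V x + y = y + V x
    & forall x, F x -> (torsion x <-> torsion (V x))].
Proof.
have Zc z y : Z z -> z + y = y + z by move=> /zeta1P/(_ y)[].
have [N [V [N0 VD Vc VZ]]] :=
  transfer F0 FD (ideal_normal_add Z_ideal) ZF Zc F_fin.
have V0 : V z0 = z0.
  by apply: (@baddI _ BR (V z0)); rewrite -VD ?badd0r.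
have V_natmul n x : F x -> V (n .* x) = n .* V x.
  by move=> hx; elim: n => //= n ih; rewrite VD ?ih //; apply: F_natmul.
exists V; split=> // x hx; split=> [[k k0 hk]|].
  by exists k; rewrite // -V_natmul // hk.
have [m m0 hm] := natmul_annihilator hx.
case=> k k0 hk; apply: (@torsion_natmul (k * (N * m))%N).
  by rewrite !muln_gt0 k0 N0.
exists 1%N => //=; rewrite badd0r !bnatmulM -VZ // V_natmul //.
by rewrite -bnatmulM mulnC bnatmulM hk bnatmul0.
Qed.

(** Two torsion elements of [F] may fail to commute, but their transfers are central, so the sum of
    the transfers is torsion and this reflects back. *)
Lemma torsion_inD x y : T x -> T y -> T (x + y).
Proof.
move=> [hx tx] [hy ty]; have [V [VD Vc Vt]] := transfer_torsion.
split; first exact: FD.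
apply: (proj2 (Vt _ (FD hx hy))); rewrite VD //; apply: torsionD.
- exact: Vc.
- exact: (proj1 (Vt _ hx)).
- exact: (proj1 (Vt _ hy)).
Qed.

Lemma torsion_inN x : T x -> T (- x).
Proof. by move=> [hx tx]; split; [apply: FN | apply: torsionN]. Qed.

Lemma torsion_in_morph (f : B -> B) x :
  (forall y z, f (y + z) = f y + f z) -> (forall y, F y -> F (f y)) ->
  T x -> T (f x).
Proof. by move=> fD fF [hx tx]; split; [apply: fF | apply: torsion_morph]. Qed.

(* [f] fixes a multiple [m x] of every [x] in [F], so [m] kills [f x - x]
   modulo torsion; the transfer reduces this to central elements. *)
Lemma torsion_in_displacement (f : B -> B) x :
  (forall y z, f (y + z) = f y + f z) -> (forall y, F y -> F (f y)) ->
  (forall z, Z z -> f z = z) -> F x -> T (f x + - x).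
Proof.
move=> fD fF fZ hx; have [V [VD Vc Vt]] := transfer_torsion.
have [m m0 hm] := natmul_annihilator hx.
have hd : F (f x + - x) by apply: FD; [apply: fF | apply: FN].
have V0 : V z0 = z0 by apply: (@baddI _ BR (V z0)); rewrite -VD ?badd0r.
have V_natmul y : F y -> V (m .* y) = m .* V y.
  by move=> hy; elim: (m) => //= n ih; rewrite VD ?ih //; apply: F_natmul.
split=> //; apply: (proj2 (Vt _ hd)); exists m => //.
have hfx := fF _ hx; have hNx := FN hx.
(* Central values let [m] distribute, and [V (m (f x)) = V (f (m x)) = V (m x)] because [m x] lies
   in [Z]. *)
rewrite VD // bnatmul_commD; last exact: Vc.
rewrite -!V_natmul // -bnatmul_morph // fZ // bnatmulN -VD; first by rewrite baddNr.
- exact: F_natmul.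
- by apply/FN/F_natmul.
Qed.

Lemma torsion_in_normal_add : normal_add BR T.
Proof.
split; [|exact: torsion_inD|exact: torsion_inN|].
  by split=> //; exists 1%N; rewrite //= badd0l.
move=> b x; apply: (torsion_in_morph (f := fun y => (b + y) + - b)).
  by move=> y z; rewrite !baddA baddNK.
by move=> y; apply: FJ.
Qed.

Lemma torsion_in_lam b x : T x -> T (lam b x).
Proof.
apply: torsion_in_morph => [y z|y]; first exact: blamD.
exact: ideal_lam.
Qed.

Lemma torsion_in_lam_fix b x : F x -> T (lam b x + - x).
Proof.
apply: torsion_in_displacement => [y z|y|z]; first exact: blamD.
  exact: ideal_lam.
by move=> /zeta1P/(_ b)[].
Qed.

Lemma torsion_in_addC b x : F x -> T (((b + x) + - b) + - x).
Proof.
apply: (torsion_in_displacement (f := fun y => (b + y) + - b)) => [y z|y|z].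
- by rewrite !baddA baddNK.
- exact: FJ.
- by move=> /zeta1P/(_ b)[_ _ <-]; rewrite baddK.
Qed.

(* Put [c := lam x b - b], which lies in [F].  Modulo [T], [lam x] fixes [c], so
   [lam (x ^ j) b = j c + b]; some power of [x] is in the annihilator. *)
Lemma torsion_in_lam_triv b x : F x -> T (lam x b + - b).
Proof.
move=> hx; set c := lam x b + - b.
have ec : lam x b = c + b by rewrite /c baddNK.
have [T0 TD TN TJ] := torsion_in_normal_add.
have hc : F c.
  (* Since [xb] is [b] times the conjugate of [x] by [inv b], the element [c] is built from [x] and
     this conjugate by operations preserving [F]. *)
  have -> : c = - x + ((b + lam b ((inv b * x) * b)) + - b).
    by rewrite -bmulE !bmulA bmulVr bmul1l /c /blam !baddA.
  apply: FD; first exact: FN.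
  by apply: FJ; apply: ideal_lam => //; apply: ideal_conjV.
split=> //; clearbody c.
have step j : exists2 t, T t & lam (iter j (bmul BR x) z0) b = (t + j .* c) + b.
  elim: j => [|j [t ht e]] /=; first by exists z0; rewrite // blam_zero !badd0l.
  pose t' := lam x (j .* c) + - (j .* c).
  exists (lam x t + t').
    apply: TD; first exact: torsion_in_lam.
    by apply: torsion_in_lam_fix; apply: F_natmul.
  rewrite blamM e !blamD ec.
  rewrite (bnatmulSr BR j c : c + j .* c = _) /t'.
  move: (lam x t) (lam x (j .* c)) => u v.
  by rewrite !baddA baddNK.
have [m m0 hm] := power_annihilator hx.
have [t [_ [k k0 hk]] e] := step m.
apply: (torsion_natmul m0).
(* The power [x ^ m] is in the annihilator, so its [lam] fixes [b] and [t + m c = 0]. *)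
have -> : m .* c = - t; last by apply: torsionN; exists k.
apply: bopp_uniq; apply: (@baddIr _ BR b); rewrite -e badd0l.
by move/zeta1P: hm => /(_ b)[].
Qed.

(** For multiplicative normality let [s] be the conjugate of [x] by [b]. Then [sb = bx] reads
    [s + lam s b = b + lam b x], which expresses [s] by an additive conjugate of [lam b x] and the
    displacement of [b] under [lam s], both in [T]. *)
Lemma torsion_in_ideal : is_ideal BR T.
Proof.
have [T0 TD TN TJ] := torsion_in_normal_add.
apply: is_ideal_intro; first exact: torsion_in_normal_add.
  exact: torsion_in_lam.
move=> b x hx; set s := (b * x) * inv b.
have hs : F s by case: hx => hx _; apply: ideal_conj.
have e : s * b = b * x by rewrite /s -bmulA bmulVl bmul1r.
have -> : s = ((b + lam b x) + - b) + - (lam s b + - b).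
  apply: (@baddIr _ BR (lam s b + - b)).
  by rewrite baddNK baddA -bmulE e bmulE.
apply: TD; first exact/TJ/torsion_in_lam.
exact/TN/torsion_in_lam_triv.
Qed.

Lemma torsion_in_central x : F x -> zeta_mod BR T x.
Proof.
move=> hx y; have hT := torsion_in_normal_add.
have h1 : bcong BR T (lam x y) y.
  exact/(bcong_diff hT)/torsion_in_lam_triv.
have h2 : bcong BR T (lam y x) x.
  exact/(bcong_diff hT)/torsion_in_lam_fix.
have h3 : bcong BR T (x + y) (y + x).
  apply: (bcong_sym hT); apply/(bcong_diff hT).
  by rewrite boppD baddA; apply: torsion_in_addC.
split=> //; rewrite !bmulE.
apply: (bcong_trans hT (bcongD hT (bcong_refl hT x) h1)).
apply: (bcong_trans hT h3).
apply: bcongD => //; first exact: bcong_refl.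
exact: bcong_sym.
Qed.

End TorsionOverAnnihilator.

(** * Quotient braces and transport along the projection *)

Section Quotient.
Variables (B : Type) (BR : brace B) (I : B -> Prop).
Hypothesis I_ideal : is_ideal BR I.

Let I_add := ideal_normal_add I_ideal.

(** Cosets are encoded as predicates so that, by extensionality, congruent elements have equal
    classes, as the equational axioms of [brace] demand. *)
Definition coset_class : Type :=
  {C : B -> Prop | exists x, C = fun y => bcong BR I y x}.

Definition proj (x : B) : coset_class :=
  exist _ (fun y => bcong BR I y x) (ex_intro _ x erefl).

Lemma proj_eq x y : proj x = proj y <-> bcong BR I x y.
Proof.
split=> [/(f_equal (fun C => sval C x)) /= <-|h]; first exact: bcong_refl.
have e : (fun u => bcong BR I u x) = (fun u => bcong BR I u y).
  apply: functional_extensionality => u; apply: propositional_extensionality.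
  split=> hu; apply: (bcong_trans I_add hu) => //.
  exact: bcong_sym.
rewrite /proj; move: (ex_intro _ x _) (ex_intro _ y _); rewrite e => p q.
by congr exist; apply: proof_irrelevance.
Qed.

Lemma proj_surj q : exists x, proj x = q.
Proof. by case: q => C [x e]; exists x; subst C. Qed.

Definition coset_repr (q : coset_class) : B :=
  proj1_sig (constructive_indefinite_description _ (proj_surj q)).

Lemma coset_reprK q : proj (coset_repr q) = q.
Proof. by rewrite /coset_repr; case: constructive_indefinite_description. Qed.

Lemma coset_repr_proj x : bcong BR I (coset_repr (proj x)) x.
Proof. by apply/proj_eq; rewrite coset_reprK. Qed.

Let qadd p q := proj (badd BR (coset_repr p) (coset_repr q)).
Let qopp p := proj (bopp BR (coset_repr p)).
Let qmul p q := proj (bmul BR (coset_repr p) (coset_repr q)).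
Let qinv p := proj (binv BR (coset_repr p)).

Let qaddE x y : qadd (proj x) (proj y) = proj (badd BR x y).
Proof. by apply/proj_eq/(bcongD I_add); apply: coset_repr_proj. Qed.

Let qoppE x : qopp (proj x) = proj (bopp BR x).
Proof. by apply/proj_eq/(bcongN I_add); apply: coset_repr_proj. Qed.

Let qmulE x y : qmul (proj x) (proj y) = proj (bmul BR x y).
Proof. by apply/proj_eq/(bcongM I_ideal); apply: coset_repr_proj. Qed.

Let qinvE x : qinv (proj x) = proj (binv BR x).
Proof. by apply/proj_eq/(bcongV I_ideal); apply: coset_repr_proj. Qed.

Definition quotient_brace : brace coset_class.
Proof.
apply: (@Brace coset_class qadd (proj (bzero BR)) qopp qmul (proj (bone BR)) qinv);
  repeat (let q := fresh "q" in move=> q; case: (proj_surj q) => ? <-);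
  rewrite ?(qoppE, qinvE) ?(qaddE, qmulE, qoppE, qinvE).
- by rewrite baddA.
- by rewrite badd0r.
- by rewrite badd0l.
- by rewrite baddNr.
- by rewrite baddNl.
- by rewrite bmulA.
- by rewrite bmul1r.
- by rewrite bmul1l.
- by rewrite bmulVr.
- by rewrite bmulVl.
- by rewrite bbrace.
Defined.

Local Notation QR := quotient_brace.

Lemma projD x y : badd QR (proj x) (proj y) = proj (badd BR x y).
Proof. exact: qaddE. Qed.

Lemma projN x : bopp QR (proj x) = proj (bopp BR x).
Proof. exact: qoppE. Qed.

Lemma projM x y : bmul QR (proj x) (proj y) = proj (bmul BR x y).
Proof. exact: qmulE. Qed.

Lemma projV x : binv QR (proj x) = proj (binv BR x).
Proof. exact: qinvE. Qed.

Lemma proj_lam x y : blam QR (proj x) (proj y) = proj (blam BR x y).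
Proof. by rewrite /blam projN projM projD. Qed.

Lemma proj_natmul n x : bnatmul QR n (proj x) = proj (bnatmul BR n x).
Proof.
elim: n => // n ih.
by rewrite -[LHS]/(badd QR (proj x) (bnatmul QR n (proj x))) ih projD.
Qed.

Lemma proj_zero x : proj x = bzero QR <-> I x.
Proof. by rewrite (proj_eq x (bzero BR)) bcong0. Qed.

Lemma bcong_proj (J : coset_class -> Prop) x y :
  bcong BR (fun u => J (proj u)) x y <-> bcong QR J (proj x) (proj y).
Proof. by rewrite /bcong projN projD. Qed.

Lemma preimage_ideal (J : coset_class -> Prop) :
  is_ideal QR J -> is_ideal BR (fun x => J (proj x)).
Proof.
move=> hJ; have [J0 JD JN JJ] := ideal_normal_add hJ.
apply: is_ideal_intro; first split=> // [x y hx hy|x hx|b x hx].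
- by rewrite -projD; apply: JD.
- by rewrite -projN; apply: JN.
- by rewrite -!projD -projN; apply: JJ.
- by move=> b x hx; rewrite -proj_lam; apply: ideal_lam.
- by move=> b x hx; rewrite -!projM -projV; apply: ideal_conj.
Qed.

Lemma image_ideal (F : B -> Prop) :
  is_ideal BR F -> is_ideal QR (fun q => exists2 x, F x & proj x = q).
Proof.
move=> hF; have [F0 FD FN FJ] := ideal_normal_add hF.
apply: is_ideal_intro; first split.
- by exists (bzero BR).
- move=> _ _ [x hx <-] [y hy <-]; rewrite projD.
  by exists (badd BR x y); first exact: FD.
- by move=> _ [x hx <-]; exists (bopp BR x); rewrite ?projN //; apply: FN.
- move=> q _ [x hx <-]; have [b <-] := proj_surj q.
  by rewrite projN !projD; eexists; first exact: (FJ b x hx).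
- move=> q _ [x hx <-]; have [b <-] := proj_surj q.
  by rewrite proj_lam; eexists; first exact: (ideal_lam b hF hx).
- move=> q _ [x hx <-]; have [b <-] := proj_surj q.
  by rewrite projV !projM; eexists; first exact: (ideal_conj b hF hx).
Qed.

Lemma zeta_mod_preimage (J : coset_class -> Prop) x :
  zeta_mod BR (fun u => J (proj u)) x <-> zeta_mod QR J (proj x).
Proof.
split=> h y.
- have [b <-] := proj_surj y; rewrite proj_lam !projD !projM.
  by case: (h b) => *; split; apply/bcong_proj.
- case: (h (proj y)); rewrite proj_lam !projD !projM.
  by move=> *; split; apply/bcong_proj.
Qed.

Lemma zeta_mod_proj x :
  zeta_mod BR I x <-> zeta_mod QR (fun q => q = bzero QR) (proj x).
Proof.
by rewrite -zeta_mod_preimage; split; apply: zeta_mod_mono => u /proj_zero.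
Qed.

Lemma zeta_mod_ideal : is_ideal BR (zeta_mod BR I).
Proof.
have -> : zeta_mod BR I =
    (fun x => zeta_mod QR (fun q => q = bzero QR) (proj x)).
  apply: functional_extensionality => x; apply: propositional_extensionality.
  exact: zeta_mod_proj.
by apply: preimage_ideal; apply: zeta1_ideal.
Qed.

(** The torsion ideal is formed in the quotient by [I], where [zeta_mod BR I] becomes the
    annihilator, and then pulled back. *)
Lemma torsion_extension (F : B -> Prop) : is_ideal BR F ->
  (forall x, zeta_mod BR I x -> F x) -> finite_mod BR F (zeta_mod BR I) ->
  exists T, [/\ is_ideal BR T, forall x, I x -> T x,
    forall x, T x -> exists2 k, 0 < k & I (bnatmul BR k x)
    & forall x, F x -> zeta_mod BR T x].
Proof.
move=> hF IF [l hl].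
pose FQ q := exists2 x, F x & proj x = q.
have hFQ : is_ideal QR FQ by apply: image_ideal.
have ZFQ q : zeta_mod QR (fun q => q = bzero QR) q -> FQ q.
  by have [x <-] := proj_surj q => /zeta_mod_proj /IF; exists x.
have finQ : finite_mod QR FQ (zeta_mod QR (fun q => q = bzero QR)).
  exists (List.map proj l) => _ [x hx <-]; have [r hr hxr] := hl x hx.
  exists (proj r); first exact: List.in_map.
  by rewrite /bcong projN projD; apply/zeta_mod_proj.
have hT := torsion_in_ideal hFQ ZFQ finQ.
exists (fun x => torsion_in QR FQ (proj x)); split.
- exact: preimage_ideal.
- by move=> x /proj_zero ->; case: hT.
- by move=> x [_ [k k0 hk]]; exists k => //; apply/proj_zero; rewrite -proj_natmul.
- move=> x hx; apply/zeta_mod_preimage; apply: torsion_in_central => //.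
  by exists x.
Qed.

End Quotient.

(** * Finiteness from supersolubility, and the two central series *)

Section Supersoluble.
Variables (B : Type) (BR : brace B).

Local Notation "a + b" := (badd BR a b).
Local Notation "- a" := (bopp BR a).
Local Notation z0 := (bzero BR).
Local Notation "n .* g" := (bnatmul BR n g) (at level 40).

Lemma normal_add_natmul I n x : normal_add BR I -> I x -> I (n .* x).
Proof. by move=> [I0 ID _ _] hx; elim: n => //= n ih; apply: ID. Qed.

Lemma finite_mod_mono (A A' C : B -> Prop) :
  (forall x, A x -> A' x) -> finite_mod BR A' C -> finite_mod BR A C.
Proof. by move=> h [l hl]; exists l => x /h; apply: hl. Qed.

(** Either [A] lies in [J], or some [t] in [A] outside [J] is congruent to a nonzero multiple of
    [g]. As a multiple of [t] lies in [J], so does [M g] for some positive [M], and coefficients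
    reduce modulo [M]. *)
Lemma cyclic_finite_mod (A J : B -> Prop) g :
  normal_add BR J -> (forall x, A x -> exists2 m, 0 < m & J (m .* x)) ->
  (forall x, A x -> exists k, bcong BR J x (k .* g) \/ bcong BR J x (- (k .* g))) ->
  finite_mod BR A J.
Proof.
move=> hJ Ators Acyc; have [J0 JD JN JJ] := hJ.
have [[t [ht htJ]]|hno] := classic (exists t, A t /\ ~ J t); last first.
  exists (z0 :: nil)%list => x hx; exists z0; first by left.
  by apply/bcong0; apply: NNPP => h; apply: hno; exists x.
have [m m0 hm] := Ators t ht; have [k hk] := Acyc t ht.
have k0 : 0 < k.
  case: k hk => // -[] /= h; case: htJ; apply/(bcong0 BR) => //.
  by rewrite bopp0 in h.
pose M := (m * k)%N; have M0 : 0 < M by rewrite muln_gt0 m0.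
have hM : J (M .* g).
  rewrite /M bnatmulM; case: hk => /(bcong_natmul hJ m) h.
    by apply: (bcong_mem hJ (fun _ => id) (bcong_sym hJ h)).
  rewrite -[m .* _](boppK BR); apply: JN; rewrite -bnatmulN.
  by apply: (bcong_mem hJ (fun _ => id) (bcong_sym hJ h)).
have red j : bcong BR J (j .* g) ((j %% M)%N .* g).
  rewrite {1}(divn_eq j M) bnatmulD bnatmulM.
  rewrite -[X in bcong BR J _ X](badd0l BR).
  apply: bcongD => //; last exact: bcong_refl.
  by apply/bcong0; apply: normal_add_natmul.
exists (List.map (fun j => j .* g) (List.seq 0 M)) => x hx.
suff [j hj] : exists j, bcong BR J x (j .* g).
  exists ((j %% M)%N .* g); last exact: bcong_trans (red j).
  apply: (List.in_map (fun i => i .* g)); apply/List.in_seq.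
  by split; [apply/leP | apply/ltP; rewrite ltn_mod].
have [j [hj|hj]] := Acyc x hx; first by exists j.
(* A negative coefficient is made nonnegative by adding [j M], whose multiple of [g] lies in [J]. *)
exists (j * M - j)%N; apply: (bcong_trans hJ hj); apply: (bcong_sym hJ).
apply/(bcong_diff hJ); rewrite boppK -bnatmulD subnK ?leq_pmulr //.
by rewrite bnatmulM; apply: normal_add_natmul.
Qed.

(** Climbing the chain modulo [D], each layer adds finitely many cosets: a prime factor is finite,
    and in a cyclic factor torsion modulo [D] bounds the part met by [T]. *)
Lemma supersoluble_torsion_finite (T D : B -> Prop) : supersoluble BR ->
  normal_add BR T -> normal_add BR D -> (forall x, D x -> T x) ->
  (forall x, T x -> exists2 k, 0 < k & D (k .* x)) -> finite_mod BR T D.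
Proof.
move=> [m [I [I0 [Im [Iid [Isub Ifac]]]]]] hT hD DT Ttors.
(* The preimage of [(I i + D) / D]. *)
pose J i x := exists2 u, I i u & bcong BR D x u.
have hJ i : i <= m -> normal_add BR (J i).
  move=> /Iid /ideal_normal_add [i0 iD iN iJ]; split.
  - by exists z0 => //; apply: bcong_refl.
  - move=> x y [u hu hxu] [v hv hyv]; exists (u + v); first exact: iD.
    exact: bcongD.
  - by move=> x [u hu hxu]; exists (- u); [apply: iN | apply: bcongN].
  - move=> b x [u hu hxu]; exists ((b + u) + - b); first exact: iJ.
    apply: bcongD => //; last exact: bcong_refl.
    by apply: bcongD => //; apply: bcong_refl.
have IJ i x : I i x -> J i x by move=> hx; exists x => //; apply: bcong_refl.
have DJ i x : i <= m -> D x -> J i x.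
  move=> /Iid [i0 _] hx; exists z0 => //; exact/bcong0.
suff fin i : i <= m -> finite_mod BR (fun x => T x /\ J i x) D.
  by apply: finite_mod_mono (fin m (leqnn m)) => x hx; split=> //; apply: IJ.
elim: i => [|i ih] im.
  exists (z0 :: nil)%list => x [_ [u /I0 -> hxu]]; exists z0 => //.
  by left.
have hJi := hJ _ (ltnW im); have [_ JD JN _] := hJ _ im; have [_ TD TN _] := hT.
apply: (finite_mod_tower hJi hD).
- by move=> x y [? ?] [? ?]; split; [apply: TD | apply: JD].
- by move=> x [? ?]; split; [apply: TN | apply: JN].
- case: (Ifac i im) => [[[g [_ [hg _]]] _]|[p [_ [s [sp [_ [_ hs]]]]]]].
  + apply: (cyclic_finite_mod (g := g)) => // x [/Ttors hx [u hu hxu]].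
      by case: hx => k k0 hk; exists k => //; apply: DJ => //; apply: ltnW.
    have [k hk] := hg u hu; exists k.
    have hxu' : bcong BR (J i) x u by apply: DJ => //; apply: ltnW.
    by case: hk => hk; [left | right]; apply: (bcong_trans hJi hxu'); apply: IJ.
  + exists s => x [_ [u hu hxu]]; have [j [jp hj]] := hs u hu.
    exists (List.nth j s z0).
      by apply: List.nth_In; apply/ltP; rewrite sp.
    apply: (@bcong_trans _ _ _ hJi u); last exact: IJ.
    by apply: DJ => //; apply: ltnW.
- by apply: finite_mod_mono (ih (ltnW im)) => x [[? _] ?].
Qed.

Local Notation zmod := (zeta_mod BR).

(* [iter n zmod I] is the preimage in [B] of [zeta_n (B / I)]. *)
Lemma iter_zeta_mod_mono n (I J : B -> Prop) :
  (forall x, I x -> J x) -> forall x, iter n zmod I x -> iter n zmod J x.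
Proof. by move=> h; elim: n => //= n ih x; apply: zeta_mod_mono. Qed.

Lemma finite_ideal_over n (I : B -> Prop) : supersoluble BR -> is_ideal BR I ->
  finite_mod BR (fun=> True) (iter n zmod I) ->
  exists T, [/\ is_ideal BR T, forall x, I x -> T x, finite_mod BR T I
    & forall x, iter n zmod T x].
Proof.
move=> hB; elim: n I => [|n ih] I hI; first by exists (fun=> True).
(* [iterSr] puts the extra [zeta_mod] innermost, so [n + 1] steps over [I] become [n] steps over
   [zeta_mod BR I]. *)
rewrite iterSr => /(ih _ (zeta_mod_ideal hI))[F [hF IF Ffin Fall]].
have [T [hT IT Ttors TF]] := torsion_extension hI hF IF Ffin.
exists T; split=> //.
  by apply: supersoluble_torsion_finite => //; apply: ideal_normal_add.
by move=> x; rewrite iterSr; apply: iter_zeta_mod_mono (Fall x).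
Qed.

Lemma gamma_gens_zeta_mod (G I : B -> Prop) x : is_ideal BR I ->
  (forall y, G y -> zmod I y) -> addgen BR (gamma_gens BR G) x -> I x.
Proof.
move=> hI GI; have hA := ideal_normal_add hI; have [I0 ID IN IJ] := hA.
elim=> // {x} [x [a [b [/GI/(_ b)[h1 h2 h3] hx]]]|x y _ hx _ hy|x _ hx];
  [|exact: ID|exact: IN].
case: hx => [->|[->|->]].
- exact/(bcong_diff hA).
(* Modulo [I], [b + lam b a = ba = ab = a + lam a b = a + b = b + a]; cancelling [b] gives
   [lam b a = a]. *)
- apply/(bcong_diff hA).
  have {}h3 : bcong BR I (b + blam BR b a) (b + a).
    rewrite -!bmulE; apply: (bcong_trans hA (bcong_sym hA h3)).
    rewrite bmulE; apply: (bcong_trans hA _ h2).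
    by apply: bcongD => //; apply: bcong_refl.
  have := bcongD hA (bcong_refl hA (- b)) h3.
  by rewrite !baddA baddNl !badd0l.
- by move: h2; rewrite /bcommA /bcong boppD !baddA.
Qed.

(** Each step of the lower series descends at least one step of the upper series over [T], starting
    from [Gamma 1 = B] at height [n]. *)
Lemma Gamma_iter_zeta_mod n k (T : B -> Prop) : is_ideal BR T ->
  (forall x, iter n zmod T x) -> k <= n ->
  forall x, Gamma BR k.+1 x -> iter (n - k) zmod T x.
Proof.
move=> hT hn; elim: k => [|k ih] kn x; first by rewrite subn0.
have hI i : is_ideal BR (iter i zmod T).
  by elim: i => //= i hi; apply: zeta_mod_ideal.
apply: gamma_gens_zeta_mod => // y /(ih (ltnW kn)).
by rewrite -(subnSK kn).
Qed.

End Supersoluble.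

Theorem theorem3p47 (B : Type) (BR : brace B) (n : nat) :
  supersoluble BR -> quot_finite BR (zeta BR n) -> set_finite (Gamma BR n.+1).
Proof.
move=> hB [s hs]; set zero := fun x => x = bzero BR.
have zetaE k : zeta BR k = iter k (zeta_mod BR) zero.
  by elim: k => //= k ->.
have [||T [hT _ [l hl] hall]] := @finite_ideal_over _ BR n zero hB.
- exact: zero_ideal.
- exists s => x _; have [i [hi hx]] := hs x.
  exists (List.nth i s (bzero BR)); last by rewrite -zetaE.
  exact/List.nth_In/ltP.
exists l => x /(Gamma_iter_zeta_mod hT hall (leqnn n)).
(* At height zero the term is [T], and congruence modulo zero is equality, so [l] itself lists
   [T]. *)
by rewrite subnn => /hl[r hr /bcong_zero ->].
Qed.
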